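(* There exists a cubic graph of order $450$ that contains no cycle of length $2^m$ for any $m \leq 5$ (that is, no cycle of length $4$, $8$, $16$ or $32$). Consequently $f(5) \leq 450$.
   Context: Graphs are finite and simple (no loops or multiple edges). A graph is cubic if every vertex has degree $3$; the order of a graph is its number of vertices. A cycle of length $n$ (an $n$-cycle) is a subgraph isomorphic to the $n$-cycle, not necessarily induced. For an integer $k \geq 2$, $f(k)$ denotes the smallest order of a cubic graph with no $2^m$-cycles for all $m \leq k$ (since graphs are simple, only $m \geq 2$ is relevant). *)

(* Defs.v *)
From HB Require Import structures.
From mathcomp Require Import all_boot.
From mathcomp Require Import boolp.

Set Implicit Arguments.
Unset Strict Implicit.
Unset Printing Implicit Defensive.

Record sgraph := SGraph {
  vertex :> finType;
  adj : rel vertex;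
  adj_sym : symmetric adj;
  adj_irrefl : irreflexive adj }.

Definition order_graph (G : sgraph) : nat := #|G|.

Definition degree (G : sgraph) (x : G) : nat := #|[set y : G | adj x y]|.

Definition cubic (G : sgraph) : Prop := forall x : G, degree x = 3.

(* The guard [2 < n] is needed because [ucycle] also accepts [:: x; y] for an
   edge xy (and the empty sequence), which are not cycles of a simple graph. *)
Definition has_cycle (G : sgraph) (n : nat) : Prop :=
  2 < n /\ exists c : seq G, size c = n /\ ucycle (@adj G) c.

Definition no_pow2_cycle (k : nat) (G : sgraph) : Prop :=
  forall m : nat, m <= k -> ~ has_cycle G (2 ^ m).

(* Graphs are nonempty: the graph with no vertices would satisfy both [cubic]
   and [no_pow2_cycle k] vacuously. *)
Definition admissible_order (k n : nat) : Prop :=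
  0 < n /\
  exists G : sgraph, [/\ order_graph G = n, cubic G & no_pow2_cycle k G].

(* The least admissible order; the default 0 is only used if there is none. *)
Definition f (k : nat) : nat :=
  if pselect (exists n, `[< admissible_order k n >]) is left ex
  then ex_minn ex else 0.

Lemma f_least (k n : nat) : admissible_order k n ->
  admissible_order k (f k) /\
  (forall n', admissible_order k n' -> f k <= n').
Proof.
move=> adm_n; rewrite /f; case: pselect => [ex|[]]; last first.
  by exists n; apply/asboolP.
case: ex_minnP => p /asboolP adm_p min_p; split=> // n' adm_n'.
by apply: min_p; apply/asboolP.
Qed.

(* Main.v *)
Require Import Defs.
From HB Require Import structures.
From mathcomp Require Import all_boot.
From mathcomp Require Import zify.
From mathcomp Require Import boolp.

Set Implicit Arguments.
Unset Strict Implicit.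
Unset Printing Implicit Defensive.

(** Each vertex of the Tutte 8-cage (30 vertices, girth 8) is replaced by a
    copy of a 15-vertex gadget, whose only vertices of degree 2 are three
    terminals, which receive the three edges of the cage.  The gadget has no
    cycle of length 4 or 8.  A cycle leaving a gadget follows a closed
    non-backtracking walk of the cage, of length at least 8, and spends at least
    4 vertices in each gadget it crosses, which gives length at least 32.
    Crossing between the terminals 1 and 2 takes at least 6 vertices, and the
    terminals are attached in such a way that every 8-cycle of the cage contains
    such a crossing, so the length is in fact at least 34. *)

(** * Construction of the graph *)

Definition gadget_nbrs (a : nat) : seq nat :=
  nth [::] [:: [:: 3; 4]; [:: 5; 11]; [:: 7; 13];
               [:: 0; 5; 6]; [:: 0; 7; 8]; [:: 1; 3; 6]; [:: 3; 5; 9];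
               [:: 2; 4; 8]; [:: 4; 7; 10]; [:: 6; 11; 12]; [:: 8; 13; 14];
               [:: 1; 9; 12]; [:: 9; 11; 14]; [:: 2; 10; 14];
               [:: 10; 12; 13]] a.

Definition gadget_adj : rel nat := fun a b => b \in gadget_nbrs a.

(* The cage is given by its LCF notation [-13, -9, 7, -7, 9, 13]^5.  Terminals
   0 and 1 carry the edges of the Hamiltonian cycle, terminal 2 the chords. *)
Definition cross (x : nat * nat) : nat * nat :=
  let: (g, i) := x in
  match i with
  | 0 => ((g + 1) %% 30, 1)
  | 1 => ((g + 29) %% 30, 0)
  | _ => ((g + nth 0 [:: 17; 21; 7; 23; 9; 13] (g %% 6)) %% 30, 2)
  end.

Definition nbrs (x : nat * nat) : seq (nat * nat) :=
  [seq (x.1, b) | b <- gadget_nbrs x.2] ++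
  (if x.2 < 3 then [:: cross x] else [::]).

(** Adjacency is defined on pairs of natural numbers, so that the finite checks evaluate without
    ordinals. *)
Definition code (u : 'I_30 * 'I_15) : nat * nat := (val u.1, val u.2).

Definition adjV : rel ('I_30 * 'I_15) := fun u v => code v \in nbrs (code u).

(** The edges inherited from the cage: a perfect matching of the terminals. *)
Definition link : rel ('I_30 * 'I_15) :=
  fun u v => (u.2 < 3) && (code v == cross (code u)).

Lemma code_inj : injective code.
Proof. by move=> [u1 u2] [v1 v2] [/val_inj -> /val_inj ->]. Qed.

Lemma codeP (x : nat * nat) :
  x.1 < 30 -> x.2 < 15 -> exists u, x = code u.
Proof. by case: x => a b /= lt_a lt_b; exists (Ordinal lt_a, Ordinal lt_b). Qed.

Lemma nbrs_check :
  all (fun g => all (fun a => let x := (g, a) in let s := nbrs x in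
    [&& uniq s, size s == 3 &
     all (fun y => [&& y.1 < 30, y.2 < 15, y != x & x \in nbrs y]) s])
    (iota 0 15)) (iota 0 30).
Proof. by vm_compute. Qed.

Lemma nbrsP (u : 'I_30 * 'I_15) :
  [/\ uniq (nbrs (code u)), size (nbrs (code u)) = 3 &
   {in nbrs (code u), forall y,
     [/\ y.1 < 30, y.2 < 15, y != code u & code u \in nbrs y]}].
Proof.
have /allP/(_ (val u.1)) := nbrs_check; rewrite mem_iota => /(_ (ltn_ord _)).
move=> /allP/(_ (val u.2)); rewrite mem_iota => /(_ (ltn_ord _)).
by case/and3P=> ? /eqP ? /allP H; split=> // y /H /and4P[].
Qed.

Lemma adjV_sym : symmetric adjV.
Proof.
suff adjVW u v : adjV u v -> adjV v u by move=> u v; apply/idP/idP; apply: adjVW.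
by have [_ _ H] := nbrsP u => /H[].
Qed.

Lemma adjV_irrefl : irreflexive adjV.
Proof.
by move=> u; apply/negP; have [_ _ H] := nbrsP u => /H[]; rewrite eqxx.
Qed.

Definition blown_up_cage : sgraph := SGraph adjV_sym adjV_irrefl.

Lemma order_blown_up_cage : order_graph blown_up_cage = 450.
Proof. by rewrite /order_graph card_prod !card_ord. Qed.

Lemma cubic_blown_up_cage : cubic blown_up_cage.
Proof.
move=> u; have [uniq_s size_s H] := nbrsP u.
rewrite /degree cardE -(size_map code) -[RHS]size_s.
apply/perm_size/uniq_perm => //.
  by rewrite map_inj_uniq ?enum_uniq //; apply: code_inj.
move=> y; apply/mapP/idP => [[v]|y_s]; first by rewrite mem_enum inE => ? ->.
have [lt1 lt2 _ _] := H _ y_s; have [v def_y] := codeP lt1 lt2.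
by exists v; rewrite // mem_enum inE /= /adjV -def_y.
Qed.

(** * Edges inside and between gadgets *)

Lemma cross_check :
  all (fun g => all (fun i =>
    [&& (cross (g, i)).1 != g, (cross (g, i)).2 < 3 &
        cross (cross (g, i)) == (g, i)]) (iota 0 3)) (iota 0 30).
Proof. by vm_compute. Qed.

Lemma linkP (u v : 'I_30 * 'I_15) :
  link u v -> u.1 != v.1 /\ link v u.
Proof.
case/andP=> lt3 /eqP def_v.
have: [&& (cross (code u)).1 != u.1, (cross (code u)).2 < 3 &
          cross (cross (code u)) == code u].
  have /allP/(_ (val u.1)) := cross_check; rewrite mem_iota => /(_ (ltn_ord _)).
  by move=> /allP/(_ (val u.2)); rewrite mem_iota => /(_ lt3).
rewrite -def_v => /and3P[neq lt_v /eqP def_u].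
by rewrite /link def_u lt_v eqxx -val_eqE eq_sym.
Qed.

Lemma link_inj (u v w : 'I_30 * 'I_15) : link u v -> link u w -> v = w.
Proof.
by move=> /andP[_ /eqP uv] /andP[_ /eqP uw]; apply: code_inj; rewrite uv uw.
Qed.

Lemma adjVE (u v : 'I_30 * 'I_15) :
  adjV u v = (u.1 == v.1) && gadget_adj u.2 v.2 || link u v.
Proof.
rewrite /adjV /nbrs mem_cat; congr (_ || _); last first.
  by rewrite /link /=; case: ifP => //; rewrite inE.
apply/mapP/andP => [[b b_u [def_v1 def_v2]]|[/eqP eq1 uv]].
  by split; [apply/eqP/val_inj | rewrite /gadget_adj def_v2].
by exists (val v.2); rewrite // /code -eq1.
Qed.

Lemma adjV_gadget (u v : 'I_30 * 'I_15) :
  adjV u v -> u.1 = v.1 -> gadget_adj u.2 v.2.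
Proof. by rewrite adjVE => /orP[/andP[]//|/linkP[/eqP]]. Qed.

Lemma adjV_link (u v : 'I_30 * 'I_15) : adjV u v -> u.1 != v.1 -> link u v.
Proof. by rewrite adjVE => /orP[/andP[->]|]. Qed.

Lemma gadget_path (x : 'I_30 * 'I_15) (p : seq ('I_30 * 'I_15)) :
  path adjV x p -> all (fun y => x.1 == y.1) p ->
  path gadget_adj x.2 [seq val y.2 | y <- p].
Proof.
elim: p x => //= y p IHp x /andP[xy yp] /andP[/eqP eq1 xp].
by rewrite adjV_gadget //= IHp // -eq1.
Qed.

Lemma last_gadget (x : 'I_30 * 'I_15) (p : seq ('I_30 * 'I_15)) :
  all (fun y => x.1 == y.1) p -> (last x p).1 = x.1.
Proof.
case/lastP: p => //= p y; rewrite last_rcons all_rcons.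
by case/andP=> /eqP.
Qed.

(** * Cycles inside a gadget *)

(** Depth-first search for a cycle through [x0], with [k] vertices still to be added. The [if] in
    place of [&&] keeps [vm_compute] from exploring branches already pruned. *)
Fixpoint completes (x0 k : nat) (visited : seq nat) (x : nat) : bool :=
  if k is k'.+1 then
    has (fun y => if y \in visited then false
                  else completes x0 k' (y :: visited) y) (gadget_nbrs x)
  else x0 \in gadget_nbrs x.

Lemma completes_path (x0 x : nat) (visited p : seq nat) :
  path gadget_adj x p -> uniq p -> ~~ has (mem visited) p ->
  gadget_adj (last x p) x0 -> completes x0 (size p) visited x.
Proof.
elim: p x visited => //= y p IHp x visited /andP[xy yp] /andP[y'p up].
rewrite negb_or => /andP[y'v v'p] last_p; apply/hasP; exists y => //.
rewrite ifN //; apply: IHp => //; apply/hasPn => z zp /=.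
by rewrite inE negb_or (hasPn v'p) // andbT; apply: contraNneq y'p => <-.
Qed.

(** Besides its starting vertex, a cycle of length 4 or 8 has 3 or 7 others. *)
Lemma completes_check :
  all (fun x => ~~ completes x 3 [:: x] x && ~~ completes x 7 [:: x] x)
    (iota 0 15).
Proof. by vm_compute. Qed.

Lemma gadget_cycle (c : seq nat) :
  ucycle gadget_adj c -> all (gtn 15) c -> (size c != 4) && (size c != 8).
Proof.
case: c => // x p /andP[] /=; rewrite rcons_path => /andP[xp px].
case/andP=> x'p up /andP[lt_x _].
have: completes x (size p) [:: x] x.
  apply: completes_path => //; apply/hasPn => z zp /=.
  by rewrite inE; apply: contraNneq x'p => <-.
have /allP/(_ x) := completes_check; rewrite mem_iota => /(_ lt_x).
case/andP=> no4 no8 closed; apply/andP; split.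
  by apply: contraNneq no4 => -[<-].
by apply: contraNneq no8 => -[<-].
Qed.

(** * Cycles leaving a gadget *)

(** Row [i] tabulates the distances in the gadget from terminal [i]. *)
Definition terminal_dist (i a : nat) : nat :=
  nth 0 (nth [::]
    [:: [:: 0; 3; 3; 1; 1; 2; 2; 2; 2; 3; 3; 4; 4; 4; 4];
        [:: 3; 0; 5; 2; 4; 1; 2; 5; 5; 2; 4; 1; 2; 4; 3];
        [:: 3; 5; 0; 4; 2; 5; 5; 1; 2; 4; 2; 4; 3; 1; 2]] i) a.

Lemma terminal_dist_check :
  all (fun i => (terminal_dist i i == 0) &&
    all (fun a => all (fun b => terminal_dist i b <= (terminal_dist i a).+1)
                      (gadget_nbrs a)) (iota 0 15)) (iota 0 3).
Proof. by vm_compute. Qed.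

(** The table vanishes at [i] and grows by at most 1 along each edge. *)
Lemma terminal_dist_path (i : nat) (p : seq nat) :
  i < 3 -> path gadget_adj i p -> terminal_dist i (last i p) <= size p.
Proof.
move=> lt_i; have /allP/(_ i) := terminal_dist_check.
rewrite mem_iota => /(_ lt_i)/andP[/eqP di /allP lip].
elim/last_ind: p => [|p y IHp]; first by rewrite /= di.
rewrite rcons_path last_rcons size_rcons => /andP[/IHp le_p py].
have lt_last : last i p < 15.
  (* From 15 on, the neighbours are the default [[::]], so the path could not continue to [y]. *)
  rewrite ltnNge; apply/negP => ge.
  by rewrite /gadget_adj /gadget_nbrs nth_default in py.
have := lip (last i p); rewrite mem_iota => /(_ lt_last)/allP/(_ _ py) le_y.
by apply: leq_trans le_y _; rewrite ltnS.
Qed.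

(* [closes k b s x] searches for a walk that enters a gadget at the terminal [x],
   leaves every gadget by another terminal than the one it came in by, meets at
   most [b] vertices, and then enters the terminal [s]; [k] is fuel. *)
Fixpoint closes (k b : nat) (s x : nat * nat) : bool :=
  if k is k'.+1 then
    has (fun j => if j == x.2 then false else
           let w := (terminal_dist x.2 j).+1 in
           if w <= b then
             let y := cross (x.1, j) in
             if y == s then true else closes k' (b - w) s y
           else false) [:: 0; 1; 2]
  else false.

Lemma closes_step (k b : nat) (s x z : nat * nat) :
  z.1 = x.1 -> z.2 < 3 -> z != x -> terminal_dist x.2 z.2 < b ->
  cross z = s \/ closes k (b - (terminal_dist x.2 z.2).+1) s (cross z) ->
  closes k.+1 b s x.
Proof.
move=> eq1 lt_z neq lt_b or_s; apply/hasP; exists z.2.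
  by case: z.2 lt_z => [|[|[|]]].
have neq2 : z.2 != x.2.
  by apply: contraNneq neq => eq2; rewrite -pair_eqE /= eq1 eq2 !eqxx.
rewrite (negPf neq2); cbv zeta; rewrite lt_b -eq1 -surjective_pairing.
by case: eqP or_s => // neq_s [/neq_s|].
Qed.

(** The girth of the cage and the placement of the terminals enter the proof through this
    computation. Each crossing costs at least one vertex, so fuel 32 suffices for 32 vertices. *)
Lemma closes_check :
  all (fun g => all (fun i => ~~ closes 32 32 (g, i) (g, i)) (iota 0 3))
    (iota 0 30).
Proof. by vm_compute. Qed.

(* [~~ link x (head s p)] says that the walk does not turn back along the cage
   edge by which it entered [x]. *)
Lemma closes_walk (k b : nat) (s x : 'I_30 * 'I_15) (p : seq ('I_30 * 'I_15)) :
  path adjV x (rcons p s) -> link (last x p) s -> x.2 < 3 ->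
  uniq (rcons p s) -> x \notin p -> ~~ link x (head s p) ->
  size p < b -> b <= k -> closes k b (code s) (code x).
Proof.
elim: k b x p => [|k IHk] b x p; first by case: b.
move=> xps last_s lt_x; rewrite rcons_uniq => /andP[s'p up] x'p x'h lt_b le_k.
(* Here [p1] is the stretch of the walk inside the gadget of [x], and [t] the vertex entered next.
   The stretch ends away from [x]: a nonempty one avoids [x], and an empty one would mean turning
   back. *)
have leave p1 t : path adjV x p1 -> all (fun y => x.1 == y.1) p1 ->
    x \notin p1 -> link (last x p1) t -> (p1 = [::] -> ~~ link x t) ->
    [/\ (last x p1).1 = x.1, last x p1 != x,
        terminal_dist x.2 (last x p1).2 <= size p1, (last x p1).2 < 3 &
        code t = cross (code (last x p1))].
  move=> xp1 in_x x'p1 /[dup] zt /andP[lt_z /eqP def_t] p1_nil; split=> //.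
  - exact: last_gadget.
  - apply: contraL zt => /eqP def_z; rewrite def_z.
    case: p1 def_z x'p1 p1_nil {xp1 in_x lt_z def_t} => [_ _ -> //|y p1' /= <-].
    by rewrite mem_last.
  have := terminal_dist_path lt_x (gadget_path xp1 in_x).
  by rewrite size_map (last_map (fun y => val y.2)).
have step p1 t (z := last x p1) (w := (terminal_dist x.2 z.2).+1) :
    path adjV x p1 -> all (fun y => x.1 == y.1) p1 -> x \notin p1 ->
    link z t -> (p1 = [::] -> ~~ link x t) -> size p1 < b ->
    (w <= (size p1).+1 -> t = s \/ closes k (b - w) (code s) (code t)) ->
    closes k.+1 b (code s) (code x).
  move=> xp1 in_x x'p1 zt p1_nil lt_p1 rec.
  have [eq1 neq le_w lt_z def_t] := leave _ _ xp1 in_x x'p1 zt p1_nil.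
  apply: (@closes_step _ _ _ _ (code z)) => //.
  - by rewrite /= eq1.
  - exact: leq_ltn_trans le_w lt_p1.
  by rewrite -def_t; case: (rec le_w) => [->|]; [left | right].
(* Cut the walk at its first vertex [y] outside the gadget of [x]; if [p] has none, this vertex is
   [s]. *)
have [in_x|] := boolP (all (fun y => x.1 == y.1) p).
  apply: (step p s) => //; last by left.
    by move: xps; rewrite rcons_path => /andP[].
  by move=> p_nil; move: x'h; rewrite p_nil.
rewrite -has_predC => p_out.
case/split_find: p_out xps last_s s'p up x'p x'h lt_b => y p1 p2 y_out.
rewrite has_predC negbK => p1_in.
rewrite cat_rcons rcons_cat cat_path last_cat /= => /and3P[xp1 zy yp2s] last_s.
rewrite mem_cat inE !negb_or cat_uniq /= => /and3P[s'p1 s'y s'p2].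
move=> /and3P[up1 p1'p2 /andP[y'p2 up2]].
rewrite mem_cat inE !negb_or => /and3P[x'p1 x'y x'p2] x'h.
rewrite size_cat /= => lt_b.
have zy_link : link (last x p1) y by apply: adjV_link; rewrite ?last_gadget.
have p1_nil : p1 = [::] -> ~~ link x y by move=> p1_nil; rewrite p1_nil in x'h.
apply: (step p1 y) => //; first by apply: leq_ltn_trans lt_b; rewrite leq_addr.
move=> le_w; right; have [_ yz] := linkP zy_link.
apply: IHk yp2s last_s _ _ y'p2 _ _ _.
- by case/andP: yz.
- by rewrite rcons_uniq s'p2.
(* Turning back at [y] would revisit [last x p1], which already occurs in [p1]. *)
- apply/negP => /(link_inj yz) def_h.
  have h_p2s : head s p2 \in rcons p2 s.
    by case: (p2) => [|v p2'] /=; rewrite ?inE eqxx.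
  have z_p1 : last x p1 \in p1.
    case: (p1) p1_nil zy_link => [/(_ erefl)/negPf ->|v p1' _ _] //=.
    exact: mem_last.
  move: h_p2s; rewrite -def_h mem_rcons inE => /predU1P[eq_s|z_p2].
    by rewrite -eq_s z_p1 in s'p1.
  by case/norP: p1'p2 => _ /hasP[]; exists (last x p1).
- by move: lt_b le_w; clear; lia.
- by move: le_k; clear; lia.
Qed.

Lemma no_short_leaving_cycle (c : seq ('I_30 * 'I_15)) (y : 'I_30 * 'I_15) :
  ucycle adjV c -> y \in c -> y.1 != (next c y).1 -> 2 < size c -> 32 < size c.
Proof.
move=> cyc_c y_c y_out gt2.
have uc : uniq c by case/andP: cyc_c.
have [i q def_c] := rot_to y_c.
move: cyc_c gt2 y_out; rewrite -(rot_ucycle i) -(size_rot i).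
rewrite -(next_rot i uc) def_c.
case: q {def_c} => [|s p]; first by [].
(* One more rotation makes the cycle start at [s], where it enters a gadget, and end at [y]. *)
rewrite -(rot_ucycle 1) -(size_rot 1) rot1_cons /= eqxx.
have: last s (rcons p y) = y by rewrite last_rcons.
move: (rcons p y) => {}p last_p.
case/andP=> sps /= /andP[s'p up] gt2 y_out.
have ys : link y s.
  by apply: adjV_link y_out; move: sps; rewrite /= rcons_path last_p => /andP[].
have [_ sy] := linkP ys; rewrite ltnNge; apply/negP => le_p.
have: closes 32 32 (code s) (code s).
  apply: (@closes_walk _ _ _ _ p) => //; first by rewrite last_p.
  - by case/andP: sy.
  - by rewrite rcons_uniq s'p.
  (* Turning back at [s] would make [y] both the first and the last vertex of [p], hence the length
     at most 2. *)
  apply/negP => /(link_inj sy) def_y; move: up gt2; rewrite def_y in last_p.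
  case: (p) last_p => [|v [|w p']] //= last_p.
  by rewrite -last_p mem_last.
have /allP/(_ (val s.1)) := closes_check; rewrite mem_iota => /(_ (ltn_ord _)).
move=> /allP/(_ (val s.2)); rewrite mem_iota => /(_ _)/negPf -> //.
by case/andP: sy.
Qed.

Lemma no_pow2_cycle_blown_up_cage : no_pow2_cycle 5 blown_up_cage.
Proof.
move=> m le_m [gt2 [c [def_n cyc_c]]].
have uc : uniq c by case/andP: cyc_c.
have le_n : size c <= 32 by rewrite def_n (leq_pexp2l _ le_m).
(* Either some edge of the cycle changes gadget, or the whole cycle lies in a single one. *)
have [same|] := boolP (all (fun y => y.1 == (next c y).1) c); last first.
  case/allPn=> y y_c y_out.
  have := no_short_leaving_cycle cyc_c y_c y_out.
  by rewrite def_n => /(_ gt2); rewrite ltnNge -def_n le_n.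
have : cycle (fun u v : 'I_30 * 'I_15 => u.1 == v.1) c.
  by apply: cycle_from_next => // y y_c; apply: (allP same).
case: c cyc_c uc def_n {le_n same} => [|x p cyc_c uc def_n].
  by move=> _ _ def_n; rewrite -def_n in gt2.
rewrite /= => in_x.
have {}in_x : all (fun y => x.1 == y.1) (rcons p x).
  by apply: order_path_min in_x => u v w /eqP-> /eqP->.
have [xpx _] := andP cyc_c.
pose d := [seq val y.2 | y <- x :: p].
have cyc_d : ucycle gadget_adj d.
  apply/andP; split; first by rewrite /= -map_rcons gadget_path.
  rewrite map_inj_in_uniq // => u v u_c v_c /val_inj eq2.
  have gx w : w \in x :: p -> x.1 = w.1.
    by rewrite -mem_rcons => /(allP in_x)/eqP.
  by apply/eqP; rewrite -pair_eqE /= /pair_eq -(gx u) // -(gx v) // eq2 !eqxx.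
have lt_d : all (gtn 15) d by apply/allP => _ /mapP[y _ ->] /=.
(* This excludes the lengths 16 and 32, leaving 4 and 8 to [gadget_cycle]. *)
have le_d : size d <= 15.
  rewrite -[15](size_iota 0); apply: uniq_leq_size; first by case/andP: cyc_d.
  by move=> a /(allP lt_d); rewrite mem_iota.
have := gadget_cycle cyc_d lt_d.
move: le_d; rewrite /d size_map def_n.
by case: m le_m gt2 {def_n} => [|[|[|[|[|[|m]]]]]].
Qed.

Theorem mainTheorem3 :
  (exists G : sgraph, [/\ cubic G, order_graph G = 450 &
     forall m : nat, m <= 5 -> ~ has_cycle G (2 ^ m)]) /\
  f 5 <= 450.
Proof.
split.
  exists blown_up_cage; split.
  - exact: cubic_blown_up_cage.
  - exact: order_blown_up_cage.
  exact: no_pow2_cycle_blown_up_cage.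
have adm : admissible_order 5 450.
  split=> //; exists blown_up_cage; split.
  - exact: order_blown_up_cage.
  - exact: cubic_blown_up_cage.
  exact: no_pow2_cycle_blown_up_cage.
by have [_] := f_least adm; apply.
Qed.
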